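(* Let $v \ge 4$ be an integer with $v \equiv 1$ or $4 \pmod{12}$ and $v \ne 13$. Then \[ \beta\left( \left\lfloor \frac{v}{4} \right\rfloor, v, 4 \right) = \frac{v(v-1)}{12}. \]
   Context: For integers $v \ge k \ge 2$, a $(v,k)$-packing is a pair $(X,\mathcal{B})$ where $X$ is a set of $v$ points and $\mathcal{B}$ is a set of $k$-subsets of $X$ (blocks) such that every pair of distinct points lies in at most one block. A partial parallel class (PPC) is a set of pairwise disjoint blocks; its size is the number of blocks. A PPC of size $\rho$ is maximum if the packing has no PPC of size $\rho+1$. $\beta(\rho,v,k)$ denotes the maximum number of blocks in a $(v,k)$-packing in which the maximum PPC has size $\rho$. *)

(* Defs.v *)
From mathcomp Require Import all_boot.
Set Implicit Arguments. Unset Strict Implicit. Unset Printing Implicit Defensive.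

Definition is_packing (v k : nat) (B : {set {set 'I_v}}) : bool :=
  [forall b in B, #|b| == k] &&
  [forall x : 'I_v, forall y : 'I_v,
     (x != y) ==> (#|[set b in B | (x \in b) && (y \in b)]| <= 1)].

Definition is_ppc (v : nat) (B P : {set {set 'I_v}}) : bool :=
  (P \subset B) &&
  [forall b1 in P, forall b2 in P, (b1 != b2) ==> [disjoint b1 & b2]].

Definition max_ppc_size (v : nat) (B : {set {set 'I_v}}) (rho : nat) : bool :=
  [exists P : {set {set 'I_v}}, is_ppc B P && (#|P| == rho)] &&
  ~~ [exists P : {set {set 'I_v}}, is_ppc B P && (#|P| == rho.+1)].

Definition beta (rho v k : nat) : nat :=
  \max_(B : {set {set 'I_v}} | is_packing k B && max_ppc_size B rho) #|B|.

(* Main.v *)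
From Stdlib Require Import BinNat.
Require Import Defs.
From mathcomp Require Import all_boot all_algebra zify.
Set Implicit Arguments. Unset Strict Implicit. Unset Printing Implicit Defensive.

(** The bound v(v-1)/12 is pair counting, so the content is the existence, for
    v = 3u + 1 with u = 0 or 1 modulo 4 and u <> 4, of a Steiner system S(2,4,v)
    with a parallel class missing no point (u = 1 mod 4) or exactly one point
    (u = 0 mod 4).  Truncate one group of a transversal design TD(5,n), 4 | n, to m
    points, give weight 3 to every point, using 4-GDDs of types 3^4 and 3^5, and
    fill each group, together with one common new point z, with a smaller system
    of the same kind: this yields the system for u = 4n + m.  Since 4 | n, the
    classes of the four full groups all miss z, and the one of the last group
    decides whether z is covered.  MacNeish's product gives TD(5,n) for all
    multiples n of 4 prime to 3; with TD(5,12), TD(5,24), TD(5,36) only 22 values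
    of u >= 1 remain, for which explicit systems are checked by computation. *)

(** * Double counting of pairs of points *)

Section Counting.

Variable T : finType.
Implicit Types (Y Z b : {set T}) (B P : {set {set T}}).

Lemma card_offdiag b :
  \sum_(p : T * T | p.1 != p.2) ((p.1 \in b) && (p.2 \in b)) = #|b| * #|b|.-1.
Proof.
rewrite -(pair_big_dep xpredT (fun x y => x != y)
            (fun x y => ((x \in b) && (y \in b) : nat))) /=.
rewrite (bigID [in b]) /= [X in _ + X]big1 ?addn0; last first.
  by move=> x /negbTE xb; rewrite big1 // => y _; rewrite xb.
rewrite -sum_nat_const; apply: eq_bigr => x xb.
rewrite (cardsD1 x b) xb add1n /= -sum1_card big_mkcond [RHS]big_mkcond /=.
by apply: eq_bigr => y _; rewrite !inE eq_sym; case: eqP; case: (y \in b).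
Qed.

Definition mult B (p : T * T) := #|[set b in B | (p.1 \in b) && (p.2 \in b)]|.

Lemma double_count B :
  \sum_(p : T * T | p.1 != p.2) mult B p = \sum_(b in B) #|b| * #|b|.-1.
Proof.
under [RHS]eq_bigr do rewrite -card_offdiag.
rewrite exchange_big /=; apply: eq_bigr => p _; rewrite /mult.
by rewrite -sum1_card big_mkcond [RHS]big_mkcond /=; apply: eq_bigr => b _;
  rewrite inE; case: (b \in B) => //=; case: (_ && _).
Qed.

Lemma count_offdiag : \sum_(p : T * T | p.1 != p.2) 1 = #|T| * #|T|.-1.
Proof.
rewrite -cardsT -card_offdiag.
by apply: eq_bigr => p _; rewrite !inE.
Qed.

Lemma packing_bound B :
  (forall b, b \in B -> #|b| = 4) -> (forall p, p.1 != p.2 -> mult B p <= 1) ->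
  12 * #|B| <= #|T| * #|T|.-1.
Proof.
move=> B4 B1; rewrite -count_offdiag mulnC -sum_nat_const.
rewrite (eq_bigr (fun b => #|b| * #|b|.-1)) => [|b /B4 ->//].
by rewrite -double_count; apply: leq_sum.
Qed.

(* Exactness is not required: by counting, the three clauses force every block
   to have 4 points and every pair to lie in exactly one block. *)
Definition design Y B :=
  [/\ forall b, b \in B -> b \subset Y /\ #|b| <= 4,
      forall x y, x \in Y -> y \in Y -> x != y ->
        exists2 b, b \in B & (x \in b) && (y \in b)
    & 12 * #|B| <= #|Y| * #|Y|.-1].

(* Here too the counting clause forces the blocks of P to be disjoint. *)
Definition pclass Z B P :=
  [/\ P \subset B, forall x, x \in Z -> exists2 b, b \in P & x \in b
    & 4 * #|P| <= #|Z|].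

(** Counting ordered pairs of distinct points gives |T|(|T|-1) <= sum of |b|(|b|-1) <= 12|B| <=
    |T|(|T|-1). Equality throughout makes both sums tight term by term, and among sizes n <= 4 only
    n = 4 gives n(n-1) = 12. *)
Lemma design_exact B : design setT B ->
  [/\ forall b, b \in B -> #|b| = 4, forall p, p.1 != p.2 -> mult B p = 1
    & 12 * #|B| = #|T| * #|T|.-1].
Proof.
case=> B4 Bcov; rewrite cardsT => Bcard.
have H1 (p : T * T) : p.1 != p.2 -> 1 <= mult B p ?= iff (1 == mult B p).
  move=> ne; split=> //; case: (Bcov p.1 p.2) => // b bB bp.
  by apply/card_gt0P; exists b; rewrite inE bB.
have H2 b : b \in B -> #|b| * #|b|.-1 <= 12 ?= iff (#|b| == 4).
  by move=> /B4[_]; case: #|b| => [|[|[|[|[|]]]]].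
have S1 := leqif_sum H1; rewrite double_count count_offdiag in S1.
have S2 := leqif_sum H2.
have S3 : \sum_(b in B) 12 = 12 * #|B| by rewrite sum_nat_const mulnC.
rewrite S3 in S2.
have E : #|T| * #|T|.-1 = 12 * #|B|.
  by apply/eqP; rewrite eqn_leq Bcard (leq_trans S1.1 S2.1).
have E2 : \sum_(b in B) #|b| * #|b|.-1 = 12 * #|B|.
  by apply/eqP; rewrite eqn_leq S2.1 -E S1.1.
split=> //.
- move: S2.2; rewrite E2 eqxx => /esym/forallP h b bB.
  by apply/eqP; have := h b; rewrite bB.
- move: S1.2; rewrite E2 E eqxx => /esym/forallP h p ne.
  by have := h p; rewrite ne eq_sym => /eqP.
Qed.

Lemma card_trivIset4 P : (forall b, b \in P -> #|b| = 4) -> trivIset P ->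
  #|cover P| = 4 * #|P|.
Proof.
move=> P4 /eqP <-; rewrite (eq_bigr (fun=> 4)) => [|b /P4 //].
by rewrite sum_nat_const mulnC.
Qed.

(** The chain |Z| <= |cover P| <= sum of |b| = 4|P| <= |Z| collapses, and equality in
    [leq_card_cover] characterises disjointness. *)
Lemma pclass_trivIset Z B P : (forall b, b \in B -> #|b| = 4) ->
  pclass Z B P -> trivIset P /\ 4 * #|P| = #|Z|.
Proof.
move=> B4 [/subsetP PB Pcov Pcard].
have ZP : #|Z| <= #|cover P|.
  apply/subset_leq_card/subsetP => x /Pcov[b bP xb].
  by apply/bigcupP; exists b.
have S : \sum_(b in P) #|b| = 4 * #|P|.
  by rewrite (eq_bigr (fun=> 4)) => [|b /PB/B4//]; rewrite sum_nat_const mulnC.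
have [h1 h2] := leq_card_cover P; rewrite S in h1 h2.
have E : 4 * #|P| = #|cover P|.
  by apply/eqP; rewrite eqn_leq h1 (leq_trans Pcard ZP).
split; first by rewrite -h2 E.
by apply/eqP; rewrite eqn_leq Pcard E ZP.
Qed.

End Counting.

(** * Systems with a prescribed parallel class, and their value for beta *)

(* The omitted point z is prescribed because the recursion glues systems along it. *)
Definition good u := forall (T : finType) (Y : {set T}) (z : T),
  z \in Y -> #|Y| = (3 * u).+1 ->
  exists B P, design Y B /\ pclass (if 4 %| u then Y :\ z else Y) B P.

Lemma beta_good u v : v = (3 * u).+1 -> (u %% 4 = 0 \/ u %% 4 = 1) -> good u ->
  beta (v %/ 4) v 4 = v * (v - 1) %/ 12.
Proof.
move=> vE uM g.
have v0 : 0 < v by lia.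
have [B [P [dB cP]]] := g 'I_v setT (Ordinal v0) (in_setT _)
  (etrans (etrans (cardsT _) (card_ord _)) vE).
have [B4 B1 Bn] := design_exact dB.
have [tP nP] := pclass_trivIset B4 cP.
have PB : P \subset B by case: cP.
(* Either 4|P| = v - 1 with v = 1 modulo 4, or 4|P| = v. *)
have Prho : #|P| = v %/ 4.
  move: nP; case: ifP => [u4|u4]; last by rewrite cardsT card_ord; lia.
  have := cardsD1 (Ordinal v0) setT.
  rewrite in_setT cardsT card_ord; move/eqP: u4; set q := #|_ :\ _|; lia.
rewrite card_ord in Bn.
have pB : is_packing 4 B.
  apply/andP; split; first by apply/forall_inP => b /B4 ->.
  apply/forallP => x; apply/forallP => y; apply/implyP => ne.
  by have := B1 (x, y) ne; rewrite /mult /= => ->.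
have ub (C : {set {set 'I_v}}) : is_packing 4 C -> 12 * #|C| <= v * v.-1.
  case/andP => /forall_inP C4 /forallP C1.
  have := @packing_bound _ C; rewrite card_ord; apply.
    by move=> b /C4/eqP.
  by case=> x y /= ne; have /forallP/(_ y) := C1 x; rewrite ne.
have mB : max_ppc_size B (v %/ 4).
  apply/andP; split.
    apply/existsP; exists P; rewrite /is_ppc PB Prho eqxx andbT /=.
    apply/forall_inP => b1 h1; apply/forall_inP => b2 h2; apply/implyP => ne.
    by move/trivIsetP: tP => /(_ _ _ h1 h2 ne).
  (* One more disjoint block would make [Q] cover 4(v %/ 4) + 4 > v points. *)
  apply/negP => /existsP[Q /andP[/andP[/subsetP QB /forall_inP Qd] /eqP Qn]].
  have tQ : trivIset Q.
    apply/trivIsetP => b1 b2 h1 h2 ne.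
    by have /forall_inP/(_ b2 h2) := Qd b1 h1; rewrite ne.
  have := card_trivIset4 (fun b h => B4 b (QB b h)) tQ.
  have : #|cover Q| <= v by rewrite -[X in _ <= X]card_ord max_card.
  lia.
rewrite subn1 -Bn mulKn //; apply/eqP; rewrite eqn_leq; apply/andP; split.
  by apply/bigmax_leqP => C /andP[/ub + _]; rewrite -Bn leq_pmul2l.
by apply: leq_bigmax_cond; rewrite pB.
Qed.

(** Images under a surjection still cover, and taking images can only lower the cardinals, which
    [design] and [pclass] bound from above. *)
Lemma design_transfer (T T' : finType) (g : T -> T') (Y Z : {set T})
    (Y' Z' : {set T'}) B P :
  {in Y, forall x, g x \in Y'} -> {in Y', forall x', exists2 x, x \in Y & g x = x'} ->
  {in Z', forall x', exists2 x, x \in Z & g x = x'} ->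
  #|Y| = #|Y'| -> #|Z| = #|Z'| -> design Y B -> pclass Z B P ->
  exists B' P', design Y' B' /\ pclass Z' B' P'.
Proof.
move=> gY gonto gZ YY ZZ [B4 Bcov Bn] [PB Pcov Pn].
exists [set g @: (b : {set T}) | b in B], [set g @: (b : {set T}) | b in P]; split; split.
- move=> _ /imsetP[b bB ->]; have [/subsetP bY b4] := B4 b bB; split.
    by apply/subsetP => _ /imsetP[x xb ->]; apply/gY/bY.
  exact: leq_trans (leq_imset_card _ _) b4.
- move=> _ _ /gonto[x xY <-] /gonto[y yY <-] ne.
  have xy : x != y by apply: contraNneq ne => ->.
  have [b bB /andP[xb yb]] := Bcov x y xY yY xy.
  by exists (g @: b); rewrite !imset_f.
- by rewrite -YY (leq_trans _ Bn) // leq_pmul2l // leq_imset_card.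
- exact: imsetS.
- move=> _ /gZ[x /Pcov[b bP xb] <-].
  by exists (g @: b); rewrite imset_f.
- by rewrite -ZZ (leq_trans _ Pn) // leq_pmul2l // leq_imset_card.
Qed.

(** A single model yields [good u], which quantifies over all types, by transport along a bijection
    taking [z] to [z']. *)
Lemma good_model u (T : finType) (Y : {set T}) (z : T) B P :
  z \in Y -> #|Y| = (3 * u).+1 ->
  design Y B -> pclass (if 4 %| u then Y :\ z else Y) B P -> good u.
Proof.
move=> zY Yn dB cP T' Y' z' zY' Yn'.
(* Both enumerations start with the distinguished point, so matching indices sends [z] to [z']. *)
pose s := z :: enum (Y :\ z); pose s' := z' :: enum (Y' :\ z').
have ss : size s = (3 * u).+1 by rewrite /= -cardE -Yn (cardsD1 z Y) zY.
have ss' : size s' = (3 * u).+1 by rewrite /= -cardE -Yn' (cardsD1 z' Y') zY'.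
have ms x : (x \in s) = (x \in Y).
  by rewrite in_cons mem_enum !inE; case: eqP => [->|].
have ms' x : (x \in s') = (x \in Y').
  by rewrite in_cons mem_enum !inE; case: eqP => [->|].
have us : uniq s by rewrite /= mem_enum !inE eqxx enum_uniq.
pose g x := nth z' s' (index x s).
have gz : g z = z' by rewrite /g /= eqxx.
have gonto x' : x' \in Y' -> exists2 x, x \in Y & g x = x'.
  rewrite -ms' => x's'; have := x's'; rewrite -index_mem ss' -ss => lt.
  exists (nth z s (index x' s')); first by rewrite -ms mem_nth.
  by rewrite /g index_uniq // nth_index.
apply: (design_transfer (g := g)) dB cP.
- by move=> x; rewrite -ms -ms' -index_mem ss -ss'; exact: mem_nth.
- exact: gonto.
- move=> x'; case: ifP => _; last exact: gonto.
  rewrite !inE => /andP[ne /gonto[x xY gx]]; exists x => //.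
  by rewrite !inE xY andbT; apply: contraNneq ne => xz; rewrite -gx xz gz.
- by rewrite Yn Yn'.
- case: ifP => _; last by rewrite Yn Yn'.
  by move: Yn Yn'; rewrite (cardsD1 z Y) (cardsD1 z' Y') zY zY' !add1n => -[->] -[->].
Qed.

(** * Transversal designs and small group divisible designs *)

(* [f i r c] is the point in the [i]-th group of the block [(r, c)] of a
   transversal design with five groups of size [n]; that exactly one block
   passes through two points of different groups follows from counting. *)
Definition td n := exists (G : finType) (f : 'I_5 -> G -> G -> G),
  [/\ #|G| = n, forall r c, f ord_max r c = c &
      forall i j x y, i != j -> exists r c, f i r c = x /\ f j r c = y].

(** MacNeish's product: the two systems of equations are solved coordinatewise. *)
Lemma td_mul m n : td m -> td n -> td (m * n).
Proof.
move=> [G [f [Gm fc fs]]] [H [g [Hn gc gs]]].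
exists (G * H)%type, (fun i r c => (f i r.1 c.1, g i r.2 c.2)); split.
- by rewrite card_prod Gm Hn.
- by move=> r [c d] /=; rewrite fc gc.
- move=> i j [x x'] [y y'] ij.
  have [r [c [<- <-]]] := fs i j x y ij; have [r' [c' [<- <-]]] := gs i j x' y' ij.
  by exists (r, r'), (c, c').
Qed.

(* Blocks of a 4-GDD of type 3^4 (resp. 3^5) as words: the letter at position i is
   the point of the block in the i-th group, 3 meaning that there is none. *)
Definition gdd4 : seq (seq nat) :=
  [:: [:: 0; 0; 0; 0; 3]; [:: 0; 1; 2; 1; 3]; [:: 0; 2; 1; 2; 3];
      [:: 1; 1; 1; 0; 3]; [:: 1; 2; 0; 1; 3]; [:: 1; 0; 2; 2; 3];
      [:: 2; 2; 2; 0; 3]; [:: 2; 0; 1; 1; 3]; [:: 2; 1; 0; 2; 3]].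

Definition gdd5 : seq (seq nat) :=
  [:: [:: 0; 0; 0; 0; 3]; [:: 0; 1; 2; 3; 2]; [:: 0; 2; 3; 1; 1];
      [:: 0; 3; 1; 2; 0]; [:: 1; 0; 3; 2; 2]; [:: 1; 1; 1; 1; 3];
      [:: 1; 2; 0; 3; 0]; [:: 1; 3; 2; 0; 1]; [:: 2; 0; 1; 3; 1];
      [:: 2; 1; 3; 0; 0]; [:: 2; 2; 2; 2; 3]; [:: 2; 3; 0; 1; 2];
      [:: 3; 0; 2; 1; 0]; [:: 3; 1; 0; 2; 1]; [:: 3; 2; 1; 0; 2]].

(** Decided by evaluation over all [i], [j], [k], [l]. The fifth letter of each word is the blank 3,
    whence the bounds on [i] and [j]. *)
Lemma gdd4P (i j : 'I_5) (k l : 'I_3) : i != j -> i < 4 -> j < 4 ->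
  exists2 w, w \in gdd4 & nth 3 w i = k /\ nth 3 w j = l.
Proof.
move=> ij i4 j4.
suff /hasP[w wg /andP[/eqP <- /eqP <-]] :
  has (fun w => (nth 3 w i == k) && (nth 3 w j == l)) gdd4 by exists w.
move: ij i4 j4.
by case: i => -[|[|[|[|[|]]]]] // ?; case: j => -[|[|[|[|[|]]]]] // ?;
  case: k => -[|[|[|]]] // ?; case: l => -[|[|[|]]] // ?.
Qed.

Lemma gdd5P (i j : 'I_5) (k l : 'I_3) : i != j ->
  exists2 w, w \in gdd5 & nth 3 w i = k /\ nth 3 w j = l.
Proof.
move=> ij.
suff /hasP[w wg /andP[/eqP <- /eqP <-]] :
  has (fun w => (nth 3 w i == k) && (nth 3 w j == l)) gdd5 by exists w.
move: ij.
by case: i => -[|[|[|[|[|]]]]] // ?; case: j => -[|[|[|[|[|]]]]] // ?;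
  case: k => -[|[|[|]]] // ?; case: l => -[|[|[|]]] // ?.
Qed.

Lemma gdd4_absent w : w \in gdd4 -> nth 3 w 4 = 3.
Proof.
by move/(allP (isT : all (fun w => nth 3 w 4 == 3) gdd4)) => /eqP.
Qed.

(** The skipped group is what limits a block to 4 points in [card_cross_block]. The size test puts
    the blank among the five actual positions. *)
Lemma gdd5_absent w : w \in gdd5 -> exists i : 'I_5, nth 3 w i = 3.
Proof.
have : all (fun w => (size w == 5) && (3 \in w)) gdd5 by [].
move/allP => h /h /andP[/eqP w5 w3]; have := w3; rewrite -index_mem w5 => lt.
by exists (Ordinal lt); rewrite nth_index.
Qed.

Lemma card_bigcup_leq (I : finType) (T : finType) (F : I -> {set T}) :
  #|\bigcup_i F i| <= \sum_i #|F i|.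
Proof.
elim/big_rec2: _ => [|i m A _ le]; first by rewrite cards0.
by rewrite (leq_trans (leq_card_setU _ _)) // leq_add2l.
Qed.

(** * Truncating and inflating a transversal design *)

Section Truncation.

Variables (G : finType) (f : 'I_5 -> G -> G -> G).

(** [None] is the common new point z; any other point consists of a group, an element of [G] and one
    of its three copies. *)
Local Notation point := (option ('I_5 * G * 'I_3)).

(** The blank 3 differs from every [k : 'I_3], so it contributes no point. *)
Definition cross_block (rc : G * G) (w : seq nat) : {set point} :=
  [set o : point | if o is Some (i, x, k) then
             (x == f i rc.1 rc.2) && (nth 3 w i == k :> nat) else false].

(** [A] restricts the index [c], which for a [td] is the point of the block in the last group. It
    thus separates the blocks that keep five points from those truncated to four. *)
Definition cross (A : {set G}) (D : seq (seq nat)) : {set {set point}} :=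
  [set cross_block p.1 (nth [::] D (p.2 : nat))
    | p : (G * G) * 'I_(size D) in setX (setX setT A) setT].

Lemma card_cross A D : #|cross A D| <= #|G| * #|A| * size D.
Proof.
by apply: leq_trans (leq_imset_card _ _) _; rewrite !cardsX !cardsT card_ord.
Qed.

Lemma mem_cross (A : {set G}) D r c w : c \in A -> w \in D ->
  cross_block (r, c) w \in cross A D.
Proof.
move=> cA wD; have lt : index w D < size D by rewrite index_mem.
apply/imsetP; exists ((r, c), Ordinal lt); first by rewrite !inE cA.
by rewrite /= nth_index.
Qed.

Lemma card_cross_block rc w (i0 : 'I_5) : nth 3 w i0 = 3 ->
  #|cross_block rc w| <= 4.
Proof.
move=> wi0.
have : cross_block rc w \subset
    [set Some (i, f i rc.1 rc.2, inord (nth 3 w i)) | i in [set~ i0]].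
  apply/subsetP => -[[[i x] k]|]; rewrite inE // => /andP[/eqP -> /eqP wi].
  apply/imsetP; exists i; last by rewrite wi inord_val.
  by rewrite !inE; apply: contraL (ltn_ord k) => /eqP ii; rewrite -wi ii wi0.
move/subset_leq_card => /leq_trans; apply.
by rewrite (leq_trans (leq_imset_card _ _)) // cardsC1 card_ord.
Qed.

End Truncation.

(** Two points of one group, or one of them and [None], are joined by the system filling that group.
    Points of different groups lie over a block of the transversal design, and the small GDD placed
    on this block joins them. *)
Lemma good_truncated n m : 4 %| n -> m <= n -> td n -> good n -> good m ->
  good (4 * n + m).
Proof.
move=> n4 mn [G [f [Gn fc fs]]] gn gm.
have [S Sm] : exists S : {set G}, #|S| = m.
  exists [set x in take m (enum G)]; rewrite cardsE.
  by rewrite (card_uniqP (take_uniq _ (enum_uniq _))) size_takel -?cardE ?Gn.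
pose T := option ('I_5 * G * 'I_3).
pose A (i : 'I_5) := if i < 4 then [set: G] else S.
pose Y : {set T} := [set o : T | if o is Some (i, x, k) then x \in A i else true].
pose Yg (i : 'I_5) : {set T} :=
  [set o : T | if o is Some (j, x, k) then (j == i) && (x \in A i) else true].
pose N (i : 'I_5) := if i < 4 then n else m.
have cA i : #|A i| = N i by rewrite /A /N; case: ifP; rewrite ?cardsT.
have cYg i : #|Yg i| = (3 * N i).+1.
  have -> : Yg i = None |: [set Some (i, p.1, p.2) | p in setX (A i) [set: 'I_3]].
    apply/setP => -[[[j x] k]|]; rewrite !inE ?eqxx //=.
    apply/andP/imsetP => [[/eqP -> xA]|[[y l]]].
      by exists (x, k); rewrite // !inE xA.
    by rewrite !inE andbT /= => yA [-> -> _]; rewrite eqxx.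
  rewrite cardsU1 card_imset; last by move=> [? ?] [? ?] [-> ->].
  rewrite cardsX cardsT card_ord cA mulnC.
  by case: imsetP => [[]//|].
have cY : #|Y| = (3 * (4 * n + m)).+1.
  have -> : Y = None |: [set Some (p.1.1, p.1.2, p.2)
     | p in setX [set q : 'I_5 * G | q.2 \in A q.1] [set: 'I_3]].
    apply/setP => -[[[j x] k]|]; rewrite !inE ?eqxx //=.
    apply/idP/imsetP => [xA|[[[i y] l]]].
      by exists (j, x, k); rewrite // !inE xA.
    by rewrite !inE andbT /= => yA [-> -> _].
  rewrite cardsU1 card_imset; last by move=> [[? ?] ?] [[? ?] ?] [-> -> ->].
  rewrite cardsX cardsT card_ord.
  have -> : #|[set q : 'I_5 * G | q.2 \in A q.1]| = \sum_(i < 5) N i.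
    rewrite -sum1_card (eq_bigl (fun q : 'I_5 * G => q.2 \in A q.1)).
      rewrite -(pair_big_dep xpredT (fun i x => x \in A i) (fun _ _ => 1)) /=.
      by apply: eq_bigr => i _; rewrite sum1_card cA.
    by move=> q; rewrite inE.
  rewrite !big_ord_recr big_ord0 /N /=.
  by case: imsetP => [[]//|_]; lia.
pose Z u (X : {set T}) := if 4 %| u then X :\ None else X.
have /fin_all_exists[F FP] (i : 'I_5) : exists BP : {set {set T}} * {set {set T}},
    design (Yg i) BP.1 /\ pclass (Z (N i) (Yg i)) BP.1 BP.2.
  have gN : good (N i) by rewrite /N; case: ifP.
  have [|B [P BP]] := gN _ (Yg i) None _ (cYg i); first by rewrite inE.
  by exists (B, P).
pose B := \bigcup_i (F i).1 :|: (cross f S gdd5 :|: cross f (~: S) gdd4).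
pose P := \bigcup_i (F i).2.
apply: (@good_model _ T Y None B P) => //; first by rewrite inE.
- split.
  + move=> b; rewrite !inE => /or3P[/bigcupP[i _ bF]|/imsetP[[[r c] w]]|/imsetP[[[r c] w]]].
    * have [[/(_ _ bF)[bY b4] _ _] _] := FP i.
      split=> //; apply: subset_trans bY _; apply/subsetP => -[[[j x] k]|]; rewrite !inE //.
      by case/andP=> /eqP ->.
    * rewrite !inE !andbT /= => cS ->; set v := nth _ _ _.
      have [i0 wi0] := gdd5_absent (mem_nth [::] (ltn_ord w)).
      split; last exact: card_cross_block wi0.
      apply/subsetP => -[[[i x] k]|]; rewrite !inE //= => /andP[/eqP -> _].
      rewrite /A; case: ltnP => [|i4]; first by rewrite inE.
      by rewrite (_ : i = ord_max) ?fc //; apply/val_inj/eqP; rewrite eqn_leq -ltnS ltn_ord i4.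
    * rewrite !inE !andbT /= => cS ->; set v := nth _ _ _.
      have v4 : nth 3 v 4 = 3 := gdd4_absent (mem_nth [::] (ltn_ord w)).
      split; last exact: (@card_cross_block _ _ _ _ ord_max).
      apply/subsetP => -[[[i x] k]|]; rewrite !inE //= => /andP[_ /eqP vi].
      rewrite /A; case: ltnP => [|i4]; first by rewrite inE.
      have i4E : i = 4 :> nat by apply/eqP; rewrite eqn_leq -ltnS ltn_ord i4.
      by have := ltn_ord k; rewrite -vi i4E v4.
  + have grp (i : 'I_5) x y : x \in Yg i -> y \in Yg i -> x != y ->
        exists2 b, b \in B & (x \in b) && (y \in b).
      move=> xi yi ne; have [[_ /(_ x y xi yi ne)[b bF bxy] _] _] := FP i.
      by exists b; rewrite // inE; apply/orP; left; apply/bigcupP; exists i.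
    move=> [[[i x] k]|] [[[j y] l]|] // + + ne; rewrite !inE => xA yA.
    * have [ij|ij] := eqVneq i j.
        by apply: (grp i); rewrite // !inE ?eqxx // ij eqxx.
      have [r [c [fx fy]]] := fs i j x y ij.
      have [cS|cS] := boolP (c \in S).
        have [w wD [wk wl]] := gdd5P k l ij.
        exists (cross_block f (r, c) w); first by rewrite !inE mem_cross ?orbT.
        by rewrite !inE /= fx fy wk wl !eqxx.
      (* A block with [c] outside [S] meets the last group in the deleted point [c], so [x] and [y]
         both lie in full groups. *)
      have lt4 (h : 'I_5) z : z \in A h -> f h r c = z -> h < 4.
        rewrite /A; case: ltnP => // h4 zS; rewrite (_ : h = ord_max) ?fc => [cz|].
          by rewrite cz zS in cS.
        by apply/val_inj/eqP; rewrite eqn_leq -ltnS ltn_ord h4.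
      have [w wD [wk wl]] := gdd4P k l ij (lt4 _ _ xA fx) (lt4 _ _ yA fy).
      exists (cross_block f (r, c) w).
        by rewrite !in_setU [_ \in cross _ (~: S) _]mem_cross ?orbT // inE.
      by rewrite !inE /= fx fy wk wl !eqxx.
    * by apply: (grp i); rewrite // !inE ?eqxx.
    * by apply: (grp j); rewrite // !inE ?eqxx.
  + have : 12 * #|\bigcup_i (F i).1| <= \sum_(i < 5) (3 * N i).+1 * (3 * N i).
      rewrite (leq_trans (leq_mul (leqnn 12) (card_bigcup_leq _))) // big_distrr /=.
      by apply: leq_sum => i _; have [[_ _]] := FP i; rewrite cYg.
    have : #|B| <= #|\bigcup_i (F i).1| + (#|cross f S gdd5| + #|cross f (~: S) gdd4|).
      by rewrite (leq_trans (leq_card_setU _ _)) // leq_add2l leq_card_setU.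
    have c5 := card_cross f S gdd5; have c4 := card_cross f (~: S) gdd4.
    have Sc : #|~: S| = n - m by rewrite cardsCs setCK Gn Sm.
    have -> : \sum_(i < 5) (3 * N i).+1 * (3 * N i) =
        4 * ((3 * n).+1 * (3 * n)) + (3 * m).+1 * (3 * m).
      by rewrite !big_ord_recr big_ord0 /N /=; lia.
    move: c5 c4; rewrite cY Sc Gn Sm /=.
    move: #|B| #|_| #|_| #|_| => b b1 b2 b3.
    (* With n = m + d and V = 12n + 3m, this rests on the identity 4(3n+1)(3n) + (3m+1)(3m) +
       12n(15m + 9d) = (V+1)V, where 15 and 9 are the sizes of [gdd5] and [gdd4]. *)
    rewrite -(subnKC mn); move: (n - m) => d; rewrite addKn; nia.
- split.
  + apply/subsetP => b /bigcupP[i _ bF]; rewrite inE; apply/orP; left; apply/bigcupP.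
    by exists i => //; have [_ [/subsetP/(_ _ bF)]] := FP i.
  + move=> x xZ.
    (* A point other than [None] is covered within its own group. [None] has to be covered only if 4
       does not divide m, and then the class of the last group does it. *)
    have [i xi] : exists i : 'I_5, x \in Z (N i) (Yg i).
      move: xZ; rewrite /Z; case: x => [[[i x] k]|] xZ.
        exists i; have xA : x \in A i by move: xZ; case: ifP; rewrite !inE.
        by case: ifP; rewrite !inE xA eqxx.
      exists ord_max; move: xZ; rewrite /N /=; case: ifP => u4; first by rewrite !inE.
      by case: ifP => m4; rewrite !inE // => _; move: u4; rewrite dvdn_addl ?dvdn_mulr // m4.
    have [_ [_ /(_ x xi)[b bF xb] _]] := FP i.
    by exists b => //; apply/bigcupP; exists i.
  + have cZ u (X : {set T}) : None \in X -> #|Z u X| = #|X| - (4 %| u).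
      move=> XN; rewrite /Z; case: ifP => _; rewrite [in RHS](cardsD1 None X) XN.
        by rewrite add1n subn1.
      by rewrite add1n subn0 [LHS](cardsD1 None X) XN.
    (* Each full group contributes 3n, its class missing [None]; the last one contributes 3m or 3m +
       1 according to whether 4 divides m. *)
    have c1 : 4 * #|P| <= \sum_(i < 5) ((3 * N i).+1 - (4 %| N i)).
      rewrite (leq_trans (leq_mul (leqnn 4) (card_bigcup_leq _))) // big_distrr /=.
      by apply: leq_sum => i _; have [_ [_ _]] := FP i; rewrite cZ ?cYg // inE.
    rewrite -/(Z _ _) cZ ?cY ?inE // (leq_trans c1) // !big_ord_recr big_ord0 /N /= n4.
    by rewrite dvdn_addr ?dvdn_mulr //; case: (4 %| m); lia.
Qed.

(** * Verification of explicit systems by computation *)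

Definition leN2 (p q : N * N) :=
  N.ltb p.1 q.1 || (N.eqb p.1 q.1 && N.leb p.2 q.2).

Definition pairsN (b c : seq N) : seq (N * N) := [seq (x, y) | x <- b, y <- c].

Definition increasing_pairs (b : seq N) : seq (N * N) :=
  [seq p <- pairsN b b | N.ltb p.1 p.2].

Definition iotaN n : seq N := [seq bin_of_nat i | i <- iota 0 n].

Lemma mem_iotaN (n x : nat) : x < n -> bin_of_nat x \in iotaN n.
Proof. by move=> xn; apply: map_f; rewrite mem_iota. Qed.

(** Points are binary numbers, for fast evaluation. [increasing_pairs (iotaN v)] is already in
    lexicographic order, so sorting the pairs of all blocks must reproduce it. If 4 divides u, the
    point missed by [P] is the last one, v - 1. *)
Definition check_design u (B P : seq (seq N)) :=
  let v := (3 * u).+1 in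
  [&& all (fun b => size b == 4) B, 12 * size B == v * v.-1,
      sort leN2 (flatten [seq increasing_pairs b | b <- B]) ==
        increasing_pairs (iotaN v),
      all (fun b => b \in B) P &
      sort N.leb (flatten P) == iotaN (if 4 %| u then v.-1 else v)].

(** Coverage is read off the sorted lists; passing from lists to sets can only lower the cardinals,
    in the direction of the required bounds. *)
Lemma check_design_good u B P : check_design u B P -> good u.
Proof.
case/and5P=> /allP B4 /eqP Bn /eqP Bcov /allP PB /eqP Pcov.
set v := (3 * u).+1 in Bn Bcov Pcov.
pose T : finType := 'I_v; pose nz := if 4 %| u then v.-1 else v.
pose blk (b : seq N) : {set T} := [set x : T | bin_of_nat (x : 'I_v) \in b].
pose sets (C : seq (seq N)) := [set:: [seq blk b | b <- C]].
have card_sets C : #|sets C| <= size C.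
  by rewrite cardsE (leq_trans (card_size _)) // size_map.
have card_blk b : #|blk b| <= size b.
  rewrite -(size_map (@nat_of_bin) b).
  have -> : #|blk b| = size [seq val x | x <- enum (blk b)] by rewrite size_map -cardE.
  apply: uniq_leq_size; first by rewrite map_inj_uniq ?enum_uniq //; exact: val_inj.
  move=> _ /mapP[x + ->]; rewrite mem_enum inE => xb.
  by apply/mapP; exists (bin_of_nat x); rewrite // bin_of_natK.
have cov (x y : 'I_v) : x < y -> exists2 b, b \in sets B & (x \in b) && (y \in b).
  move=> xy; have : (bin_of_nat x, bin_of_nat y) \in increasing_pairs (iotaN v).
    rewrite mem_filter /=; apply/andP; split.
      by apply/N.ltb_lt; lia.
    by apply/allpairsP; exists (bin_of_nat x, bin_of_nat y); split;
      rewrite ?mem_iotaN.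
  rewrite -Bcov mem_sort => /flattenP[_ /mapP[b bB ->]].
  rewrite mem_filter => /andP[_ /allpairsP[[i j] /= [ib jb [xi yj]]]].
  exists (blk b); first by rewrite inE map_f.
  by rewrite !inE xi yj ib.
apply: (@good_model u T setT ord_max (sets B) (sets P)) => //.
- by rewrite cardsT card_ord.
- split.
  + move=> _ /[!inE] /mapP[b bB ->]; split; first exact: subsetT.
    by rewrite (leq_trans (card_blk b)) // (eqP (B4 b bB)).
  + move=> x y _ _; rewrite neq_ltn => /orP[/cov//|/cov[b bB]].
    by rewrite andbC; exists b.
  + by rewrite cardsT card_ord -Bn leq_mul2l card_sets.
- split.
  + by apply/subsetP => _ /[!inE] /mapP[b /PB bB ->]; exact: map_f.
  + move=> x xZ.
    have xn : x < nz.
      move: xZ; rewrite /nz; case: ifP => _; last by rewrite ltn_ord.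
      by rewrite !inE andbT ltn_neqAle -ltnS ltn_ord andbT.
    have : bin_of_nat x \in iotaN nz by rewrite mem_iotaN.
    rewrite -Pcov mem_sort => /flattenP[b bP xb].
    by exists (blk b); rewrite inE // map_f.
  + have -> : #|if 4 %| u then [set: T] :\ ord_max else [set: T]| = nz.
      rewrite /nz; case: ifP => _; last by rewrite cardsT card_ord.
      by have := cardsD1 (ord_max : T) setT; rewrite inE cardsT card_ord => -[].
    have <- : size (flatten P) = nz.
      by rewrite -(size_sort N.leb) Pcov size_map size_iota.
    rewrite (leq_trans (leq_mul (leqnn 4) (card_sets P))) //.
    (* Every block listed in [P] is in [B], hence has length 4, so that 4 * [size P] is the length
       of [flatten P]. *)
    rewrite size_flatten /shape sumnE big_map mulnC -sum1_size.
    rewrite big_distrl /= big_seq [leqRHS]big_seq.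
    by apply: leq_sum => b /PB /B4 /eqP ->.
Qed.

(** * Explicit systems of small order *)

(* [(n, k, b)] stands for the [n] first iterates of the block [b] under the
   permutation [x |-> x + k] of the residues modulo [m], the points [x >= m] being fixed. *)
Definition develop (m : nat) (ds : seq (nat * nat * seq nat)) : seq (seq N) :=
  let mN := bin_of_nat m in
  flatten [seq let kN := bin_of_nat d.1.2 in
    traject (map (fun x => if N.ltb x mN then N.modulo (x + kN)%num mN else x))
      (map bin_of_nat d.2) d.1.1 | d <- ds].

(* Found by computer search.  For v = 40, 52, 64, 76, 88, 124, 136, 184 these are
   cyclic difference families, the orbit of the subgroup of order 4 being the
   parallel class; for v = 37, 49, 61 they are cyclic with a listed class.  For
   v = 12t + 1 >= 73 a cyclic 4-GDD of type 12^t on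
   Z_12t is completed by projective planes of order 3 on the groups with one more
   point 12t; three of its blocks meeting every residue modulo 12 once, developed by
   multiples of 12, form the class. *)
Lemma good1 : good 1.
Proof.
pose dB := [:: (1, 1, [:: 0; 1; 2; 3])].
pose dP := [:: (1, 1, [:: 0; 1; 2; 3])].
by apply: (@check_design_good _ (develop 4 dB) (develop 4 dP)); vm_compute.
Qed.

(** The affine plane of order 4, with an automorphism of order 15 fixing the point 15. *)
Lemma good5 : good 5.
Proof.
pose dB := [:: (5, 1, [:: 0; 5; 10; 15]); (15, 1, [:: 0; 1; 3; 7])].
pose dP := [:: (1, 1, [:: 0; 5; 10; 15]); (1, 1, [:: 1; 2; 4; 8]);
  (1, 1, [:: 6; 7; 9; 13]); (1, 1, [:: 11; 12; 14; 3])].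
by apply: (@check_design_good _ (develop 15 dB) (develop 15 dP)); vm_compute.
Qed.

(** A difference family over Z_5 x Z_5, the pair (x, y) being coded as 5x + y. Its base blocks are
    0, 1, 5, 12 and 0, 2, 10, 24: shifts of y are written out, shifts of x come from [develop]. *)
Lemma good8 : good 8.
Proof.
pose dB := [:: (5, 5, [:: 0; 1; 5; 12]); (5, 5, [:: 1; 2; 6; 13]);
  (5, 5, [:: 2; 3; 7; 14]); (5, 5, [:: 3; 4; 8; 10]);
  (5, 5, [:: 4; 0; 9; 11]); (5, 5, [:: 0; 2; 10; 24]);
  (5, 5, [:: 1; 3; 11; 20]); (5, 5, [:: 2; 4; 12; 21]);
  (5, 5, [:: 3; 0; 13; 22]); (5, 5, [:: 4; 1; 14; 23])].
pose dP := [:: (1, 1, [:: 18; 19; 23; 0]); (1, 1, [:: 7; 9; 17; 1]);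
  (1, 1, [:: 15; 16; 20; 2]); (1, 1, [:: 3; 4; 8; 10]);
  (1, 1, [:: 11; 13; 21; 5]); (1, 1, [:: 12; 14; 22; 6])].
by apply: (@check_design_good _ (develop 25 dB) (develop 25 dP)); vm_compute.
Qed.

(** Z_7 acts by steps of 4 with four point orbits; the nine base blocks yield 63 = 28 * 27 / 12
    blocks, and the first block orbit is the class. *)
Lemma good9 : good 9.
Proof.
pose dB := [:: (7, 4, [:: 0; 1; 2; 3]); (7, 4, [:: 2; 7; 12; 25]);
  (7, 4, [:: 0; 4; 10; 26]); (7, 4, [:: 0; 5; 12; 9]);
  (7, 4, [:: 0; 7; 19; 20]); (7, 4, [:: 1; 7; 17; 15]);
  (7, 4, [:: 2; 6; 21; 13]); (7, 4, [:: 3; 7; 14; 22]);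
  (7, 4, [:: 0; 11; 14; 17])].
pose dP := [:: (7, 4, [:: 0; 1; 2; 3])].
by apply: (@check_design_good _ (develop 28 dB) (develop 28 dP)); vm_compute.
Qed.

Lemma good12 : good 12.
Proof.
pose dB := [:: (37, 1, [:: 0; 8; 20; 27]); (37, 1, [:: 0; 3; 24; 1]);
  (37, 1, [:: 0; 4; 26; 32])].
pose dP := [:: (1, 1, [:: 13; 16; 0; 14]); (1, 1, [:: 1; 9; 21; 28]);
  (1, 1, [:: 3; 6; 27; 4]); (1, 1, [:: 7; 10; 31; 8]);
  (1, 1, [:: 22; 26; 11; 17]); (1, 1, [:: 15; 23; 35; 5]);
  (1, 1, [:: 12; 20; 32; 2]); (1, 1, [:: 29; 33; 18; 24]);
  (1, 1, [:: 30; 34; 19; 25])].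
by apply: (@check_design_good _ (develop 37 dB) (develop 37 dP)); vm_compute.
Qed.

Lemma good13 : good 13.
Proof.
pose dB := [:: (10, 1, [:: 0; 10; 20; 30]); (40, 1, [:: 0; 11; 32; 14]);
  (40, 1, [:: 0; 9; 2; 15]); (40, 1, [:: 0; 17; 1; 5])].
pose dP := [:: (10, 1, [:: 0; 10; 20; 30])].
by apply: (@check_design_good _ (develop 40 dB) (develop 40 dP)); vm_compute.
Qed.

Lemma good16 : good 16.
Proof.
pose dB := [:: (49, 1, [:: 0; 3; 39; 35]); (49, 1, [:: 0; 1; 41; 30]);
  (49, 1, [:: 0; 16; 28; 43]); (49, 1, [:: 0; 7; 31; 5])].
pose dP := [:: (1, 1, [:: 21; 37; 0; 15]); (1, 1, [:: 1; 17; 29; 44]);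
  (1, 1, [:: 24; 40; 3; 18]); (1, 1, [:: 16; 19; 6; 2]);
  (1, 1, [:: 46; 47; 38; 27]); (1, 1, [:: 4; 7; 43; 39]);
  (1, 1, [:: 23; 26; 13; 9]); (1, 1, [:: 5; 12; 36; 10]);
  (1, 1, [:: 30; 31; 22; 11]); (1, 1, [:: 41; 8; 20; 35]);
  (1, 1, [:: 33; 34; 25; 14]); (1, 1, [:: 42; 45; 32; 28])].
by apply: (@check_design_good _ (develop 49 dB) (develop 49 dP)); vm_compute.
Qed.

Lemma good17 : good 17.
Proof.
pose dB := [:: (13, 1, [:: 0; 13; 26; 39]); (52, 1, [:: 0; 10; 18; 43]);
  (52, 1, [:: 0; 5; 40; 2]); (52, 1, [:: 0; 15; 4; 36]);
  (52, 1, [:: 0; 7; 1; 29])].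
pose dP := [:: (13, 1, [:: 0; 13; 26; 39])].
by apply: (@check_design_good _ (develop 52 dB) (develop 52 dP)); vm_compute.
Qed.

Lemma good20 : good 20.
Proof.
pose dB := [:: (61, 1, [:: 0; 33; 2; 26]); (61, 1, [:: 0; 49; 27; 46]);
  (61, 1, [:: 0; 4; 40; 48]); (61, 1, [:: 0; 52; 32; 14]);
  (61, 1, [:: 0; 5; 50; 60])].
pose dP := [:: (1, 1, [:: 45; 49; 24; 32]); (1, 1, [:: 48; 39; 19; 1]);
  (1, 1, [:: 26; 31; 15; 25]); (1, 1, [:: 51; 55; 30; 38]);
  (1, 1, [:: 4; 56; 36; 18]); (1, 1, [:: 3; 8; 53; 2]);
  (1, 1, [:: 35; 7; 37; 0]); (1, 1, [:: 40; 12; 42; 5]);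
  (1, 1, [:: 44; 16; 46; 9]); (1, 1, [:: 21; 54; 23; 47]);
  (1, 1, [:: 41; 13; 43; 6]); (1, 1, [:: 57; 29; 59; 22]);
  (1, 1, [:: 10; 14; 50; 58]); (1, 1, [:: 20; 11; 52; 34]);
  (1, 1, [:: 28; 33; 17; 27])].
by apply: (@check_design_good _ (develop 61 dB) (develop 61 dP)); vm_compute.
Qed.

Lemma good21 : good 21.
Proof.
pose dB := [:: (16, 1, [:: 0; 16; 32; 48]); (64, 1, [:: 0; 9; 53; 12]);
  (64, 1, [:: 0; 1; 28; 58]); (64, 1, [:: 0; 18; 60; 31]);
  (64, 1, [:: 0; 2; 17; 56]); (64, 1, [:: 0; 5; 50; 26])].
pose dP := [:: (16, 1, [:: 0; 16; 32; 48])].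
by apply: (@check_design_good _ (develop 64 dB) (develop 64 dP)); vm_compute.
Qed.

Lemma good24 : good 24.
Proof.
(* The first 13 entries are the translates modulo 13 of the difference set 0, 1, 3, 9, multiplied by
   t = 6. They form a projective plane on the multiples of 6 up to 72, and the shifts carry it to
   the other groups while fixing 72. *)
pose dB := [:: (6, 1, [:: 0; 6; 18; 54]); (6, 1, [:: 6; 12; 24; 60]);
  (6, 1, [:: 12; 18; 30; 66]); (6, 1, [:: 18; 24; 36; 72]);
  (6, 1, [:: 24; 30; 42; 0]); (6, 1, [:: 30; 36; 48; 6]);
  (6, 1, [:: 36; 42; 54; 12]); (6, 1, [:: 42; 48; 60; 18]);
  (6, 1, [:: 48; 54; 66; 24]); (6, 1, [:: 54; 60; 72; 30]);
  (6, 1, [:: 60; 66; 0; 36]); (6, 1, [:: 66; 72; 6; 42]);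
  (6, 1, [:: 72; 0; 12; 48]); (72, 1, [:: 0; 33; 11; 56]);
  (72, 1, [:: 0; 20; 7; 51]); (72, 1, [:: 0; 34; 2; 69]);
  (72, 1, [:: 0; 1; 64; 47]); (72, 1, [:: 0; 19; 62; 4])].
pose dP := [:: (6, 12, [:: 0; 33; 11; 56]); (6, 12, [:: 10; 30; 17; 61]);
  (6, 12, [:: 3; 4; 67; 50])].
by apply: (@check_design_good _ (develop 72 dB) (develop 72 dP)); vm_compute.
Qed.

Lemma good25 : good 25.
Proof.
pose dB := [:: (19, 1, [:: 0; 19; 38; 57]); (76, 1, [:: 0; 25; 20; 12]);
  (76, 1, [:: 0; 33; 10; 17]); (76, 1, [:: 0; 34; 61; 75]);
  (76, 1, [:: 0; 22; 24; 72]); (76, 1, [:: 0; 3; 58; 47]);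
  (76, 1, [:: 0; 6; 37; 46])].
pose dP := [:: (19, 1, [:: 0; 19; 38; 57])].
by apply: (@check_design_good _ (develop 76 dB) (develop 76 dP)); vm_compute.
Qed.

Lemma good28 : good 28.
Proof.
pose dB := [:: (7, 1, [:: 0; 7; 21; 63]); (7, 1, [:: 7; 14; 28; 70]);
  (7, 1, [:: 14; 21; 35; 77]); (7, 1, [:: 21; 28; 42; 84]);
  (7, 1, [:: 28; 35; 49; 0]); (7, 1, [:: 35; 42; 56; 7]);
  (7, 1, [:: 42; 49; 63; 14]); (7, 1, [:: 49; 56; 70; 21]);
  (7, 1, [:: 56; 63; 77; 28]); (7, 1, [:: 63; 70; 84; 35]);
  (7, 1, [:: 70; 77; 0; 42]); (7, 1, [:: 77; 84; 7; 49]);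
  (7, 1, [:: 84; 0; 14; 56]); (84, 1, [:: 0; 16; 26; 18]);
  (84, 1, [:: 0; 34; 45; 72]); (84, 1, [:: 0; 36; 4; 3]);
  (84, 1, [:: 0; 23; 40; 53]); (84, 1, [:: 0; 37; 62; 43]);
  (84, 1, [:: 0; 5; 60; 69])].
pose dP := [:: (7, 12, [:: 0; 23; 40; 53]); (7, 12, [:: 2; 25; 42; 55]);
  (7, 12, [:: 8; 45; 70; 51])].
by apply: (@check_design_good _ (develop 84 dB) (develop 84 dP)); vm_compute.
Qed.

Lemma good29 : good 29.
Proof.
pose dB := [:: (22, 1, [:: 0; 22; 44; 66]); (88, 1, [:: 0; 24; 7; 72]);
  (88, 1, [:: 0; 27; 78; 52]); (88, 1, [:: 0; 43; 39; 57]);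
  (88, 1, [:: 0; 6; 56; 85]); (88, 1, [:: 0; 28; 8; 13]);
  (88, 1, [:: 0; 19; 86; 53]); (88, 1, [:: 0; 41; 87; 11])].
pose dP := [:: (22, 1, [:: 0; 22; 44; 66])].
by apply: (@check_design_good _ (develop 88 dB) (develop 88 dP)); vm_compute.
Qed.

Lemma good36 : good 36.
Proof.
pose dB := [:: (9, 1, [:: 0; 9; 27; 81]); (9, 1, [:: 9; 18; 36; 90]);
  (9, 1, [:: 18; 27; 45; 99]); (9, 1, [:: 27; 36; 54; 108]);
  (9, 1, [:: 36; 45; 63; 0]); (9, 1, [:: 45; 54; 72; 9]);
  (9, 1, [:: 54; 63; 81; 18]); (9, 1, [:: 63; 72; 90; 27]);
  (9, 1, [:: 72; 81; 99; 36]); (9, 1, [:: 81; 90; 108; 45]);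
  (9, 1, [:: 90; 99; 0; 54]); (9, 1, [:: 99; 108; 9; 63]);
  (9, 1, [:: 108; 0; 18; 72]); (108, 1, [:: 0; 48; 79; 33]);
  (108, 1, [:: 0; 20; 4; 3]); (108, 1, [:: 0; 26; 95; 34]);
  (108, 1, [:: 0; 24; 89; 68]); (108, 1, [:: 0; 6; 76; 86]);
  (108, 1, [:: 0; 42; 67; 97]); (108, 1, [:: 0; 7; 2; 58]);
  (108, 1, [:: 0; 12; 85; 71])].
pose dP := [:: (9, 12, [:: 0; 20; 4; 3]); (9, 12, [:: 2; 22; 6; 5]);
  (9, 12, [:: 7; 13; 83; 93])].
by apply: (@check_design_good _ (develop 108 dB) (develop 108 dP)); vm_compute.
Qed.

Lemma good41 : good 41.
Proof.
pose dB := [:: (31, 1, [:: 0; 31; 62; 93]); (124, 1, [:: 0; 3; 113; 89]);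
  (124, 1, [:: 0; 7; 12; 48]); (124, 1, [:: 0; 1; 116; 22]);
  (124, 1, [:: 0; 49; 106; 108]); (124, 1, [:: 0; 37; 92; 63]);
  (124, 1, [:: 0; 51; 34; 47]); (124, 1, [:: 0; 27; 79; 33]);
  (124, 1, [:: 0; 53; 68; 28]); (124, 1, [:: 0; 10; 80; 60]);
  (124, 1, [:: 0; 58; 39; 81])].
pose dP := [:: (31, 1, [:: 0; 31; 62; 93])].
by apply: (@check_design_good _ (develop 124 dB) (develop 124 dP)); vm_compute.
Qed.

Lemma good44 : good 44.
Proof.
pose dB := [:: (11, 1, [:: 0; 11; 33; 99]); (11, 1, [:: 11; 22; 44; 110]);
  (11, 1, [:: 22; 33; 55; 121]); (11, 1, [:: 33; 44; 66; 132]);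
  (11, 1, [:: 44; 55; 77; 0]); (11, 1, [:: 55; 66; 88; 11]);
  (11, 1, [:: 66; 77; 99; 22]); (11, 1, [:: 77; 88; 110; 33]);
  (11, 1, [:: 88; 99; 121; 44]); (11, 1, [:: 99; 110; 132; 55]);
  (11, 1, [:: 110; 121; 0; 66]); (11, 1, [:: 121; 132; 11; 77]);
  (11, 1, [:: 132; 0; 22; 88]); (132, 1, [:: 0; 13; 71; 39]);
  (132, 1, [:: 0; 8; 20; 43]); (132, 1, [:: 0; 15; 107; 16]);
  (132, 1, [:: 0; 2; 29; 127]); (132, 1, [:: 0; 54; 102; 60]);
  (132, 1, [:: 0; 56; 123; 53]); (132, 1, [:: 0; 45; 114; 64]);
  (132, 1, [:: 0; 49; 86; 122]); (132, 1, [:: 0; 4; 108; 51]);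
  (132, 1, [:: 0; 21; 38; 52])].
pose dP := [:: (11, 12, [:: 0; 2; 29; 127]); (11, 12, [:: 4; 6; 33; 131]);
  (11, 12, [:: 8; 10; 37; 3])].
by apply: (@check_design_good _ (develop 132 dB) (develop 132 dP)); vm_compute.
Qed.

Lemma good45 : good 45.
Proof.
pose dB := [:: (34, 1, [:: 0; 34; 68; 102]); (136, 1, [:: 0; 62; 120; 132]);
  (136, 1, [:: 0; 6; 46; 53]); (136, 1, [:: 0; 32; 91; 42]);
  (136, 1, [:: 0; 5; 69; 100]); (136, 1, [:: 0; 8; 109; 81]);
  (136, 1, [:: 0; 56; 75; 113]); (136, 1, [:: 0; 54; 21; 71]);
  (136, 1, [:: 0; 3; 25; 51]); (136, 1, [:: 0; 18; 134; 125]);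
  (136, 1, [:: 0; 13; 106; 14]); (136, 1, [:: 0; 52; 37; 76])].
pose dP := [:: (34, 1, [:: 0; 34; 68; 102])].
by apply: (@check_design_good _ (develop 136 dB) (develop 136 dP)); vm_compute.
Qed.

Lemma good52 : good 52.
Proof.
pose dB := [:: (13, 1, [:: 0; 13; 39; 117]); (13, 1, [:: 13; 26; 52; 130]);
  (13, 1, [:: 26; 39; 65; 143]); (13, 1, [:: 39; 52; 78; 156]);
  (13, 1, [:: 52; 65; 91; 0]); (13, 1, [:: 65; 78; 104; 13]);
  (13, 1, [:: 78; 91; 117; 26]); (13, 1, [:: 91; 104; 130; 39]);
  (13, 1, [:: 104; 117; 143; 52]); (13, 1, [:: 117; 130; 156; 65]);
  (13, 1, [:: 130; 143; 0; 78]); (13, 1, [:: 143; 156; 13; 91]);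
  (13, 1, [:: 156; 0; 26; 104]); (156, 1, [:: 0; 40; 47; 3]);
  (156, 1, [:: 0; 68; 82; 80]); (156, 1, [:: 0; 63; 135; 41]);
  (156, 1, [:: 0; 19; 83; 54]); (156, 1, [:: 0; 18; 107; 103]);
  (156, 1, [:: 0; 66; 36; 16]); (156, 1, [:: 0; 23; 118; 145]);
  (156, 1, [:: 0; 58; 15; 48]); (156, 1, [:: 0; 31; 128; 86]);
  (156, 1, [:: 0; 17; 96; 9]); (156, 1, [:: 0; 57; 32; 132]);
  (156, 1, [:: 0; 45; 46; 51])].
pose dP := [:: (13, 12, [:: 0; 40; 47; 3]); (13, 12, [:: 2; 42; 49; 5]);
  (13, 12, [:: 9; 32; 127; 154])].
by apply: (@check_design_good _ (develop 156 dB) (develop 156 dP)); vm_compute.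
Qed.

Lemma good61 : good 61.
Proof.
pose dB := [:: (46, 1, [:: 0; 46; 92; 138]); (184, 1, [:: 0; 2; 171; 9]);
  (184, 1, [:: 0; 37; 139; 118]); (184, 1, [:: 0; 56; 153; 109]);
  (184, 1, [:: 0; 32; 164; 50]); (184, 1, [:: 0; 85; 142; 62]);
  (184, 1, [:: 0; 35; 159; 143]); (184, 1, [:: 0; 61; 34; 129]);
  (184, 1, [:: 0; 58; 63; 141]); (184, 1, [:: 0; 28; 40; 176]);
  (184, 1, [:: 0; 26; 181; 117]); (184, 1, [:: 0; 10; 6; 125]);
  (184, 1, [:: 0; 11; 90; 107]); (184, 1, [:: 0; 73; 49; 19]);
  (184, 1, [:: 0; 38; 183; 112]); (184, 1, [:: 0; 86; 170; 137])].
pose dP := [:: (46, 1, [:: 0; 46; 92; 138])].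
by apply: (@check_design_good _ (develop 184 dB) (develop 184 dP)); vm_compute.
Qed.

Lemma good68 : good 68.
Proof.
pose dB := [:: (17, 1, [:: 0; 17; 51; 153]); (17, 1, [:: 17; 34; 68; 170]);
  (17, 1, [:: 34; 51; 85; 187]); (17, 1, [:: 51; 68; 102; 204]);
  (17, 1, [:: 68; 85; 119; 0]); (17, 1, [:: 85; 102; 136; 17]);
  (17, 1, [:: 102; 119; 153; 34]); (17, 1, [:: 119; 136; 170; 51]);
  (17, 1, [:: 136; 153; 187; 68]); (17, 1, [:: 153; 170; 204; 85]);
  (17, 1, [:: 170; 187; 0; 102]); (17, 1, [:: 187; 204; 17; 119]);
  (17, 1, [:: 204; 0; 34; 136]); (204, 1, [:: 0; 29; 30; 75]);
  (204, 1, [:: 0; 2; 58; 35]); (204, 1, [:: 0; 52; 73; 66]);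
  (204, 1, [:: 0; 83; 3; 44]); (204, 1, [:: 0; 15; 78; 114]);
  (204, 1, [:: 0; 18; 10; 77]); (204, 1, [:: 0; 74; 182; 178]);
  (204, 1, [:: 0; 24; 164; 116]); (204, 1, [:: 0; 54; 143; 193]);
  (204, 1, [:: 0; 71; 84; 166]); (204, 1, [:: 0; 69; 42; 118]);
  (204, 1, [:: 0; 79; 9; 132]); (204, 1, [:: 0; 31; 47; 19]);
  (204, 1, [:: 0; 93; 87; 184]); (204, 1, [:: 0; 55; 98; 199]);
  (204, 1, [:: 0; 62; 172; 25])].
pose dP := [:: (17, 12, [:: 0; 29; 30; 75]); (17, 12, [:: 4; 33; 34; 79]);
  (17, 12, [:: 8; 37; 38; 83])].
by apply: (@check_design_good _ (develop 204 dB) (develop 204 dP)); vm_compute.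
Qed.

Lemma good84 : good 84.
Proof.
pose dB := [:: (21, 1, [:: 0; 21; 63; 189]); (21, 1, [:: 21; 42; 84; 210]);
  (21, 1, [:: 42; 63; 105; 231]); (21, 1, [:: 63; 84; 126; 252]);
  (21, 1, [:: 84; 105; 147; 0]); (21, 1, [:: 105; 126; 168; 21]);
  (21, 1, [:: 126; 147; 189; 42]); (21, 1, [:: 147; 168; 210; 63]);
  (21, 1, [:: 168; 189; 231; 84]); (21, 1, [:: 189; 210; 252; 105]);
  (21, 1, [:: 210; 231; 0; 126]); (21, 1, [:: 231; 252; 21; 147]);
  (21, 1, [:: 252; 0; 42; 168]); (252, 1, [:: 0; 40; 68; 71]);
  (252, 1, [:: 0; 95; 204; 148]); (252, 1, [:: 0; 82; 30; 233]);
  (252, 1, [:: 0; 103; 177; 92]); (252, 1, [:: 0; 46; 60; 59]);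
  (252, 1, [:: 0; 110; 34; 133]); (252, 1, [:: 0; 64; 130; 152]);
  (252, 1, [:: 0; 102; 145; 195]); (252, 1, [:: 0; 33; 38; 65]);
  (252, 1, [:: 0; 78; 54; 216]); (252, 1, [:: 0; 44; 127; 172]);
  (252, 1, [:: 0; 118; 39; 2]); (252, 1, [:: 0; 113; 87; 58]);
  (252, 1, [:: 0; 12; 175; 248]); (252, 1, [:: 0; 41; 47; 108]);
  (252, 1, [:: 0; 81; 98; 91]); (252, 1, [:: 0; 72; 183; 201]);
  (252, 1, [:: 0; 20; 237; 117]); (252, 1, [:: 0; 106; 115; 227]);
  (252, 1, [:: 0; 86; 94; 156])].
pose dP := [:: (21, 12, [:: 0; 40; 68; 71]); (21, 12, [:: 6; 109; 183; 98]);
  (21, 12, [:: 7; 125; 46; 9])].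
by apply: (@check_design_good _ (develop 252 dB) (develop 252 dP)); vm_compute.
Qed.

(** * Constructions of transversal designs *)

Section CyclicTD.
Import GRing.Theory.
Local Open Scope ring_scope.

(** Two of the slopes 0, 1, 2, 3 differ by at most 3 in absolute value, hence by a unit modulo n,
    which determines [c] and then [r]. *)
Lemma td_cyclic (n : nat) : (1 < n)%N -> coprime n 6 -> td n.
Proof.
move=> n1 n6; have kU (k : nat) : (0 < k < 4)%N -> (k%:R : 'Z_n) \is a GRing.unit.
  case/andP=> k0 k4; rewrite unitZpE //; apply: coprime_dvdr n6; rewrite ?prime_coprime //.
  by move: k k0 k4 => [|[|[|[|]]]].
have dU (i j : nat) : (i < 4)%N -> (j < 4)%N -> i != j ->
    (j%:R - i%:R : 'Z_n) \is a GRing.unit.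
  move=> i4 j4; rewrite neq_ltn => /orP[ij|ji].
    by rewrite -natrB 1?ltnW // kU //; lia.
  by rewrite -opprB unitrN -natrB 1?ltnW // kU //; lia.
exists 'Z_n, (fun i r c => if i == ord_max then c else r + i%:R * c).
split=> [|r c|i j x y]; [by rewrite card_ord Zp_cast | by rewrite eqxx |].
have lt4 (k : 'I_5) : k != ord_max -> (k < 4)%N.
  by move=> k4; rewrite ltn_neqAle -ltnS ltn_ord andbT.
move=> ij; have [iE|i4] := boolP (i == ord_max);
  have [jE|j4] := boolP (j == ord_max).
- by rewrite (eqP iE) (eqP jE) eqxx in ij.
- by exists (y - j%:R * x), x; rewrite subrK.
- by exists (x - i%:R * y), y; rewrite subrK.
have U := dU i j (lt4 i i4) (lt4 j j4) ij.
pose c := (y - x) / (j%:R - i%:R); exists (x - i%:R * c), c; split; first by rewrite subrK.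
by rewrite -addrA [- _ + _]addrC -mulrBl mulrC /c divrK // addrC subrK.
Qed.

End CyclicTD.

(* A difference matrix over Z_a x Z_b, the pair (x, y) being coded as x * b + y;
   its first row is zero, and the fifth group is indexed by the columns. *)
Definition addN (a b x y : N) : N :=
  (N.modulo (x / b + y / b) a * b + N.modulo (N.modulo x b + N.modulo y b) b)%num.

Definition dm_word a b (D2 D3 : seq N) (r c : N) : seq N :=
  [:: r; addN a b r c; addN a b r (nth 0%num D2 c); addN a b r (nth 0%num D3 c); c].

Definition check_dm a b (D2 D3 : seq nat) :=
  let n := a * b in
  let A := bin_of_nat a in let B := bin_of_nat b in
  let W := [seq dm_word A B (map bin_of_nat D2) (map bin_of_nat D3) r c
             | r <- iotaN n, c <- iotaN n] in
  all (fun ij => (ij.1 == ij.2) ||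
      (sort leN2 [seq (nth 0%num w ij.1, nth 0%num w ij.2) | w <- W] ==
        pairsN (iotaN n) (iotaN n)))
    [seq (i, j) | i <- iota 0 5, j <- iota 0 5].

Lemma check_dm_td a b D2 D3 : check_dm a b D2 D3 -> td (a * b).
Proof.
set n := a * b; rewrite /check_dm -/n; set w := dm_word _ _ _ _ => /allP chk.
(* The default of [insubd] is taken from the arguments, as ['I_n] has no inhabitant when n = 0. *)
exists 'I_n, (fun (i : 'I_5) r c =>
  insubd c (nat_of_bin (nth 0%num (w (bin_of_nat (r : 'I_n)) (bin_of_nat (c : 'I_n))) i))).
split; first by rewrite card_ord.
  by move=> r c /=; rewrite bin_of_natK valKd.
move=> i j x y ij.
have /chk : (nat_of_ord i, nat_of_ord j) \in [seq (i, j) | i <- iota 0 5, j <- iota 0 5].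
  by apply: allpairs_f; rewrite mem_iota ltn_ord.
rewrite /= (negbTE (ij : i != j :> nat)) /= => /eqP cov.
have : (bin_of_nat x, bin_of_nat y) \in pairsN (iotaN n) (iotaN n).
  by apply: allpairs_f; apply: mem_iotaN.
rewrite -cov mem_sort => /mapP[_ /allpairsP[[r c] /= [rn cn ->]] [xi yj]].
move: rn cn xi yj => /mapP[r' + ->] /mapP[c' + ->]; rewrite !mem_iota /= !add0n => rn cn xi yj.
exists (Ordinal rn), (Ordinal cn); split.
  by rewrite /= -xi bin_of_natK valKd.
by rewrite /= -yj bin_of_natK valKd.
Qed.

(** The two rows are the multiplications by the elements 2 and 3 of the field of order 4. *)
Lemma td4 : td 4.
Proof.
by apply: (@check_dm_td 2 2 [:: 0; 2; 3; 1] [:: 0; 3; 1; 2]); vm_compute.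
Qed.

Lemma td8 : td 8.
Proof.
by apply: (@check_dm_td 2 4 [:: 0; 5; 4; 1; 3; 2; 7; 6]
  [:: 0; 2; 6; 4; 7; 3; 1; 5]); vm_compute.
Qed.

Lemma td9 : td 9.
Proof.
by apply: (@check_dm_td 3 3 [:: 0; 7; 5; 1; 8; 3; 2; 6; 4]
  [:: 0; 3; 6; 7; 1; 4; 5; 8; 2]); vm_compute.
Qed.

(** Nontrivial factorisations of 12 and 24 involve 2, 3 or 6, orders without a transversal design
    with five groups; so [td_mul] reaches neither. *)
Lemma td12 : td 12.
Proof.
by apply: (@check_dm_td 2 6 [:: 0; 8; 5; 7; 3; 11; 10; 9; 4; 2; 1; 6]
  [:: 0; 3; 11; 8; 2; 7; 1; 5; 9; 6; 4; 10]); vm_compute.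
Qed.

Lemma td24 : td 24.
Proof.
by apply: (@check_dm_td 2 12
  [:: 0; 4; 13; 10; 5; 17; 3; 20; 15; 23; 19; 9; 6; 18; 16; 8; 12; 21; 2; 11; 14; 7; 1; 22]
  [:: 0; 3; 19; 2; 7; 18; 16; 1; 22; 21; 6; 17; 13; 23; 10; 12; 20; 9; 5; 14; 11; 4; 15; 8]);
  vm_compute.
Qed.

(** A power of 2 that is at least 4 is a product of 4s and at most one 8; the remaining odd factor
    is prime to 6 and handled by [td_cyclic]. *)
Lemma td_div4 (n : nat) : 0 < n -> 4 %| n -> ~~ (3 %| n) -> td n.
Proof.
elim/ltn_ind: n => n IHn n0 /dvdnP[q nq] n3.
have q0 : 0 < q by lia.
have q3 : ~~ (3 %| q) by apply: contraNN n3 => q3; rewrite nq dvdn_mulr.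
have odd_td k : odd k -> ~~ (3 %| k) -> k = 1 \/ td k.
  move=> k2 k3; have [->|k1] := eqVneq k 1; [by left | right].
  apply: td_cyclic; first by lia.
  by rewrite (coprimeMr k 2 3) coprimen2 k2 coprime_sym prime_coprime.
have [q2|q2] := boolP (odd q).
  by rewrite nq; have [->|tq] := odd_td q q2 q3; [exact: td4 | exact: td_mul td4].
have [q4|q4] := boolP (4 %| q).
  by rewrite nq; apply: td_mul td4; apply: IHn => //; lia.
have qE : q = q./2 * 2 by lia.
have h3 : ~~ (3 %| q./2) by apply: contraNN q3 => h3; rewrite qE dvdn_mulr.
have h2 : odd q./2 by lia.
rewrite nq qE -mulnA; have [->|tq] := odd_td _ h2 h3; [exact: td8 | exact: td_mul td8].
Qed.

(** * The recursion on the order *)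

(** This degenerate case stands for m = 0, the deletion of the whole last group. *)
Lemma good0 : good 0.
Proof.
move=> T Y z zY Y1; have Yz : Y = [set z].
  by apply/esym/eqP; rewrite eqEcard sub1set zY cards1 Y1.
exists set0, set0; rewrite Yz setDv; split; split; rewrite ?cards0 //.
- by move=> b; rewrite inE.
- by move=> x y /set1P-> /set1P->; rewrite eqxx.
- by move=> x; rewrite inE.
Qed.

Definition base_orders : seq nat :=
  [:: 0; 1; 5; 8; 9; 12; 13; 16; 17; 20; 21; 24; 25; 28; 29; 36; 41; 44; 45; 52; 61; 68; 84].

Lemma good_base u : u \in base_orders -> good u.
Proof.
rewrite !inE.
do 22! [case/predU1P => [->|]; first by
  [ exact: good0 | exact: good1 | exact: good5 | exact: good8 | exact: good9
  | exact: good12 | exact: good13 | exact: good16 | exact: good17 | exact: good20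
  | exact: good21 | exact: good24 | exact: good25 | exact: good28 | exact: good29
  | exact: good36 | exact: good41 | exact: good44 | exact: good45 | exact: good52
  | exact: good61 | exact: good68 ]].
by move/eqP->; exact: good84.
Qed.

Definition td_orders : seq nat := [:: 8; 12; 16; 20; 24; 28; 32; 36; 40].

Lemma td_small n : n \in td_orders -> td n.
Proof.
have [n3 nt|n3] := boolP (3 %| n); last first.
  by move=> nt; apply: td_div4 n3; move: nt; rewrite !inE; lia.
have : n \in [:: 12; 24; 36] by move: n3 nt; rewrite !inE; lia.
rewrite !inE => /or3P[] /eqP->; [exact: td12 | exact: td24 | exact: (td_mul td4 td9)].
Qed.

(** Both 4 < n and u <> 4n + 4 keep the recursion away from order 4, that is v = 13: any two blocks
    of a projective plane of order 3 meet. The bound u <= 5n says m <= n. *)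
Lemma decomposition u : u %% 4 <= 1 -> u != 4 -> u \notin base_orders ->
  exists n, [/\ 4 %| n, 4 < n, td n & [&& 4 * n <= u, u <= 5 * n & u != 4 * n + 4]].
Proof.
move=> u1 u4 ub; have [u_small|u_large] := ltnP u 176.
  have : all (fun w => [&& w %% 4 <= 1, w != 4 & w \notin base_orders] ==>
      has (fun n => [&& 4 * n <= w, w <= 5 * n & w != 4 * n + 4]) td_orders) (iota 0 176).
    by vm_compute.
  move/allP/(_ u); rewrite mem_iota u1 u4 ub => /(_ u_small)/hasP[n nt un].
  by exists n; split=> //; [move: nt; rewrite !inE; lia | move: nt; rewrite !inE; lia
    | exact: td_small].
(* With n = 4k, one of q, q - 1, q - 2 serves as k. The last is called for only if u = 16q + 4, and
   16q + 4 <= 20(q - 2) amounts to q >= 11, that is u >= 176. *)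
have [k [k3 ku]] : exists k, ~~ (3 %| k) /\
    [&& 11 < k + 3, 16 * k <= u, u <= 20 * k & u != 16 * k + 4].
  pose q := u %/ 16.
  have [h|h] := boolP (~~ (3 %| q) && (u != 16 * q + 4)); first by exists q; lia.
  have [h1|h1] := boolP (~~ (3 %| q.-1)); first by exists q.-1; lia.
  by exists q.-2; lia.
by exists (4 * k); split; [exact: dvdn_mulr | lia | apply: td_div4; lia | lia].
Qed.

Lemma good_all u : u %% 4 <= 1 -> u != 4 -> good u.
Proof.
elim/ltn_ind: u => u IHu u1 u4; have [/good_base//|ub] := boolP (u \in base_orders).
have [n [n4 n_gt4 tn /and3P[le1 le2 ne]]] := decomposition u1 u4 ub.
rewrite (_ : u = 4 * n + (u - 4 * n)); last by lia.
by apply: good_truncated; rewrite ?leq_subLR //; try (apply: IHu; lia); lia.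
Qed.

Theorem theorem4p7 (v : nat) :
  4 <= v -> (v %% 12 = 1 \/ v %% 12 = 4) -> v <> 13 ->
  beta (v %/ 4) v 4 = v * (v - 1) %/ 12.
Proof.
(* Here v = 3u + 1 with u = [v %/ 3], and v = 13 is u = 4. *)
move=> v4 v12 v13; apply: (@beta_good (v %/ 3)); [lia | lia |].
by apply: good_all; lia.
Qed.
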